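(* Let $X$ be a set. The wire $$F_{\mathrm{cw}}(X)=F_w(X)/[F_w(X),F_w(X)]_\circ$$ is the free commutative wire on the set $X$.
   Context: A wire is a triple $(W,\star,\circ)$ with $(W,\star)$ a group, $(W,\circ)$ a semigroup, and $a\circ(b\star c)=(a\circ b)\star a^{-1}\star(a\circ c)$, $(b\star c)\circ a=(b\circ a)\star a^{-1}\star(c\circ a)$ for all $a,b,c\in W$, where $a^{-1}$ is the inverse with respect to $\star$. It is commutative if $\circ$ is commutative. A wire morphism is a map preserving $\star$ and $\circ$. A free commutative wire on $X$ is a commutative wire $V$ with a map $\iota\colon X\to V$ such that for every commutative wire $W$ and map $f\colon X\to W$ there is a unique wire morphism $\hat f\colon V\to W$ with $\hat f\iota=f$. Let $M(X)$ be the free semigroup (without identity) generated by $X$, with operation $\circ$, and let $P(X)$ be the free group generated by the set $M(X)$, with operation $\star$ and neutral element $e$. Write elements of $P(X)$ as $u=\prod_{i=1}^n u_i^{\epsilon_i}=u_1^{\epsilon_1}\star\cdots\star u_n^{\epsilon_n}$ with $u_i\in M(X)$, $\epsilon_i\in\{1,-1\}$ (ordered product, not necessarily reduced). For $l\in M(X)$ put $$l\circ u=l\star\prod_{i=1}^n\bigl(l^{-1}\star(l\circ u_i)\bigr)^{\epsilon_i},\qquad u\circ l=\Bigl(\prod_{i=1}^n\bigl((u_i\circ l)\star l^{-1}\bigr)^{\epsilon_i}\Bigr)\star l.$$ For $u=\prod_{i=1}^n u_i^{\epsilon_i}$ and $v=\prod_{j=1}^m v_j^{\delta_j}$ in $P(X)$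 put $$u\circ_r v=\Bigl(\prod_{i=1}^n\bigl((u_i\circ v)\star v^{-1}\bigr)^{\epsilon_i}\Bigr)\star v,\qquad u\circ_l v=u\star\prod_{j=1}^m\bigl(u^{-1}\star(u\circ v_j)\bigr)^{\delta_j}.$$ None of these depends on the chosen word representatives. Let $P(X)^2$ (respectively $P(X)^2_{\mathrm{op}}$) be the normal subgroup of $P(X)$ generated by the elements $m^{-1}\star(m\circ l)\star l^{-1}$ (respectively $m^{-1}\star(l\circ m)\star l^{-1}$) for $m,l\in M(X)$, and let $[P(X)^2,P(X)^2_{\mathrm{op}}]$ be the subgroup generated by the commutators $a\star b\star a^{-1}\star b^{-1}$ with $a\in P(X)^2$, $b\in P(X)^2_{\mathrm{op}}$. Then $F_w(X)=P(X)/[P(X)^2,P(X)^2_{\mathrm{op}}]$, with the induced $\star$ and $[u]\circ[v]=[u\circ_l v]=[u\circ_r v]$, is a wire (the two classes coincide and the operation is well defined). The circle commutator $[P(X),P(X)]_\circ$ is the normal subgroup of $(P(X),\star)$ generated by the elements $(x_1\circ\cdots\circ x_n)^{-1}\star(x_{\sigma(1)}\circ\cdots\circ x_{\sigma(n)})$ with $x_1,\dots,x_n\in X$ and $\sigma\in\operatorname{Sym}(n)$, and $$[F_w(X),F_w(X)]_\circ=\bigl([P(X),P(X)]_\circ\star[P(X)^2,P(X)^2_{\mathrm{op}}]\bigr)/[P(X)^2,P(X)^2_{\mathrm{op}}].$$ It is an ideal of $F_w(X)$, so both operations descend to the quotient group $F_w(X)/[F_w(X),F_w(X)]_\circ$,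 which is thereby a wire. The map from $X$ is $x\mapsto[x]$. *)

(* Defs.v *)
From HB Require Import structures.
From Stdlib Require Import Relations.
From mathcomp Require Import all_boot perm.
From mathcomp Require Import generic_quotient.
From mathcomp Require Import boolp classical_sets.

Set Implicit Arguments.
Unset Strict Implicit.
Unset Printing Implicit Defensive.

Local Open Scope classical_set_scope.
Local Open Scope group_scope.
Local Open Scope quotient_scope.

HB.mixin Record Group_isWire W of monoid.Group W := {
  circ : W -> W -> W;
  circA : associative circ;
  circMr : forall a b c : W, circ a (b * c) = circ a b * a^-1 * circ a c;
  circMl : forall a b c : W, circ (b * c) a = circ b a * a^-1 * circ c a
}.

#[short(type="wireType")]
HB.structure Definition Wire := { W of Group_isWire W & monoid.Group W }.

Definition commutative_wire (W : wireType) := commutative (@circ W).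

Definition wire_morphism (V W : wireType) (g : V -> W) :=
  {morph g : a b / a * b >-> a * b} /\
  {morph g : a b / circ a b >-> circ a b}.

Definition is_free_commutative_wire (X : Type) (V : wireType) (iota : X -> V) :=
  commutative_wire V /\
  forall (W : wireType) (f : X -> W), commutative_wire W ->
    exists! g : V -> W, wire_morphism g /\ forall x, g (iota x) = f x.

Arguments is_free_commutative_wire X V iota : clear implicits.

Section Subgroups.
Variable G : groupType.
Implicit Types (A H : set G).

Definition is_subgroup H :=
  [/\ H 1, forall x y, H x -> H y -> H (x * y) & forall x, H x -> H x^-1].

Definition is_normal H :=
  is_subgroup H /\ forall x g, H x -> H (x ^ g).

Definition gen_subgroup A : set G := smallest is_subgroup A.
Definition gen_normal A : set G := smallest is_normal A.

Lemma gen_subgroup_is_subgroup A : is_subgroup (gen_subgroup A).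
Proof.
split=> [H [] []//|x y Hx Hy H HH|x Hx H HH].
  by have [_ HM _] := HH.1; apply: HM; [apply: Hx|apply: Hy].
by have [_ _ HV] := HH.1; apply: HV; apply: Hx.
Qed.

Lemma gen_normal_is_normal A : is_normal (gen_normal A).
Proof.
split; last by move=> x g Hx H HH; apply: (HH.1).2; apply: Hx.
split=> [H [] [] []//|x y Hx Hy H HH|x Hx H HH].
  by have [_ HM _] := (HH.1).1; apply: HM; [apply: Hx|apply: Hy].
by have [_ _ HV] := (HH.1).1; apply: HV; apply: Hx.
Qed.

Lemma gen_normalJ A x g : gen_normal A x -> gen_normal A (x ^ g).
Proof. by have [_] := gen_normal_is_normal A; apply. Qed.

Lemma gen_normalV A x : gen_normal A x -> gen_normal A x^-1.
Proof. by have [[_ _ +] _] := gen_normal_is_normal A; apply. Qed.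

Lemma gen_subgroup1 A : gen_subgroup A 1.
Proof. by have [? _ _] := gen_subgroup_is_subgroup A. Qed.

Lemma gen_subgroupM A x y :
  gen_subgroup A x -> gen_subgroup A y -> gen_subgroup A (x * y).
Proof. by have [_ + _] := gen_subgroup_is_subgroup A; apply. Qed.

Lemma gen_subgroupV A x : gen_subgroup A x -> gen_subgroup A x^-1.
Proof. by have [_ _] := gen_subgroup_is_subgroup A; apply. Qed.

End Subgroups.

Record normalSubgroup (G : groupType) := NormalSubgroup {
  normal_set :> G -> Prop;
  normal_setP : is_normal normal_set
}.

Section QuotientGroup.
Variables (G : groupType) (N : normalSubgroup G).

Let N1 : N 1. Proof. by have [[]] := normal_setP N. Qed.
Let NM x y : N x -> N y -> N (x * y).
Proof. by have [[_ + _] _] := normal_setP N; apply. Qed.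
Let NV x : N x -> N x^-1.
Proof. by have [[_ _ +] _] := normal_setP N; apply. Qed.
Let NJ x g : N x -> N (x ^ g).
Proof. by have [_] := normal_setP N; apply. Qed.

Definition coset_rel : rel G := fun x y => `[< N (x^-1 * y) >].

Lemma coset_rel_refl : reflexive coset_rel.
Proof. by move=> x; apply/asboolP; rewrite mulVg. Qed.

Lemma coset_rel_sym : symmetric coset_rel.
Proof.
move=> x y; apply/asboolP/asboolP=> /NV; by rewrite invgM invgK.
Qed.

Lemma coset_rel_trans : transitive coset_rel.
Proof.
move=> y x z /asboolP Nxy /asboolP Nyz; apply/asboolP.
by have := NM Nxy Nyz; rewrite mulgA mulgK.
Qed.

Canonical coset_equiv :=
  EquivRel coset_rel coset_rel_refl coset_rel_sym coset_rel_trans.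

Definition quotg := {eq_quot coset_equiv}.

HB.instance Definition _ := Choice.on quotg.

Definition proj (x : G) : quotg := \pi_quotg x.

Lemma projP x y : proj x = proj y <-> N (x^-1 * y).
Proof.
split=> [/eqmodP/asboolP//|Nxy]; by apply/eqmodP/asboolP.
Qed.

Lemma proj_eq1 x : proj x = proj 1 <-> N x.
Proof.
split=> [/esym/projP|Nx]; first by rewrite invg1 mul1g.
by apply/esym/projP; rewrite invg1 mul1g.
Qed.

Lemma projW (Q : quotg -> Prop) : (forall x, Q (proj x)) -> forall a, Q a.
Proof. by move=> Qp a; rewrite -[a]reprK; apply: Qp. Qed.

Definition quotg_mul (a b : quotg) := proj (repr a * repr b).
Definition quotg_inv (a : quotg) := proj (repr a)^-1.

Lemma proj_repr a : proj (repr a) = a.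
Proof. exact: reprK. Qed.

Lemma quotg_mulE x y : quotg_mul (proj x) (proj y) = proj (x * y).
Proof.
apply/projP; set x' := repr _; set y' := repr _.
have /projP Nx : proj x' = proj x by rewrite proj_repr.
have /projP Ny : proj y' = proj y by rewrite proj_repr.
rewrite (_ : _ * _ = (x'^-1 * x) ^ y' * (y'^-1 * y)); first exact: NM (NJ _ _) _.
by rewrite conjgE invgM !mulgA mulgK.
Qed.

Lemma quotg_invE x : quotg_inv (proj x) = proj x^-1.
Proof.
apply/projP; set x' := repr _.
have /projP Nx : proj x' = proj x by rewrite proj_repr.
rewrite invgK (_ : _ * _ = (x'^-1 * x)^-1 ^ x'^-1); first exact/NJ/NV.
by rewrite conjgE invgM !invgK !mulgA mulgK.
Qed.

Let quotg_mulA : associative quotg_mul.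
Proof.
elim/projW=> x; elim/projW=> y; elim/projW=> z.
by rewrite !quotg_mulE mulgA.
Qed.
Let quotg_mul1 : left_id (proj 1) quotg_mul.
Proof. by elim/projW=> x; rewrite quotg_mulE mul1g. Qed.
Let quotg_mulg1 : right_id (proj 1) quotg_mul.
Proof. by elim/projW=> x; rewrite quotg_mulE mulg1. Qed.
Let quotg_mulV : left_inverse (proj 1) quotg_inv quotg_mul.
Proof. by elim/projW=> x; rewrite quotg_invE quotg_mulE mulVg. Qed.
Let quotg_mulgV : right_inverse (proj 1) quotg_inv quotg_mul.
Proof. by elim/projW=> x; rewrite quotg_invE quotg_mulE mulgV. Qed.

HB.instance Definition _ := isGroup.Build quotg
  quotg_mulA quotg_mul1 quotg_mulg1 quotg_mulV quotg_mulgV.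

Lemma projM : {morph proj : x y / x * y}.
Proof. by move=> x y; rewrite -quotg_mulE. Qed.
Lemma projV : {morph proj : x / x^-1}.
Proof. by move=> x; rewrite -quotg_invE. Qed.
Lemma proj1 : proj 1 = 1. Proof. by []. Qed.

End QuotientGroup.

Section FreeGroup.
Variable T : choiceType.

(* [(t, true)] stands for t and [(t, false)] for t^-1. *)
Definition fgword := seq (T * bool).

HB.instance Definition _ := Choice.on fgword.

Inductive fgcancel : fgword -> fgword -> Prop :=
  FgCancel s t b r : fgcancel (s ++ (t, b) :: (t, ~~ b) :: r) (s ++ r).

Definition fgrel : rel fgword :=
  fun s r => `[< clos_refl_sym_trans _ fgcancel s r >].

Lemma fgrel_refl : reflexive fgrel.
Proof. by move=> s; apply/asboolP; apply: rst_refl. Qed.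
Lemma fgrel_sym : symmetric fgrel.
Proof. by move=> s r; apply/asboolP/asboolP; apply: rst_sym. Qed.
Lemma fgrel_trans : transitive fgrel.
Proof.
move=> s r q /asboolP rs /asboolP sq; apply/asboolP.
exact: rst_trans rs sq.
Qed.

Canonical fg_equiv := EquivRel fgrel fgrel_refl fgrel_sym fgrel_trans.

Definition freeGroup := {eq_quot fg_equiv}.

HB.instance Definition _ := Choice.on freeGroup.

Definition fgclass (s : fgword) : freeGroup := \pi_freeGroup s.

Lemma fgclassP s r : fgclass s = fgclass r <-> clos_refl_sym_trans _ fgcancel s r.
Proof.
split=> [/eqmodP/asboolP//|sr]; by apply/eqmodP/asboolP.
Qed.

Lemma fgclass_repr a : fgclass (repr a) = a. Proof. exact: reprK. Qed.

Lemma fgclassW (Q : freeGroup -> Prop) : (forall s, Q (fgclass s)) -> forall a, Q a.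
Proof. by move=> Qp a; rewrite -[a]fgclass_repr; apply: Qp. Qed.

Lemma fgclass_compat (U : Type) (h : fgword -> U) :
  (forall s r, fgcancel s r -> h s = h r) ->
  forall s r, fgclass s = fgclass r -> h s = h r.
Proof.
move=> hc s r /fgclassP; elim=> {s r} [s r /hc//|//|//|s r q _ -> _ ->//].
Qed.

Definition fginvw (s : fgword) : fgword := rev [seq (a.1, ~~ a.2) | a <- s].

Definition fg_mul (a b : freeGroup) := fgclass (repr a ++ repr b).
Definition fg_inv (a : freeGroup) := fgclass (fginvw (repr a)).

Lemma fg_mulE s r : fg_mul (fgclass s) (fgclass r) = fgclass (s ++ r).
Proof.
transitivity (fgclass (s ++ repr (fgclass r))).
- apply: (fgclass_compat (h := fun s => fgclass (s ++ repr (fgclass r)))).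
    move=> _ _ [p t b q]; apply/fgclassP; rewrite -!catA /=; exact/rst_step.
  exact: fgclass_repr.
- apply: (fgclass_compat (h := fun r => fgclass (s ++ r))).
    move=> _ _ [p t b q]; apply/fgclassP; rewrite !catA; exact/rst_step.
  exact: fgclass_repr.
Qed.

Lemma fg_invE s : fg_inv (fgclass s) = fgclass (fginvw s).
Proof.
apply: (fgclass_compat (h := fun r => fgclass (fginvw r))); last exact: fgclass_repr.
move=> _ _ [p t b q]; apply/fgclassP.
rewrite /fginvw !map_cat !rev_cat /= !rev_cons negbK -!cats1 -!catA /=.
rewrite -[in X in clos_refl_sym_trans _ _ X _](negbK b) negbK.
by apply: rst_step; have := FgCancel (rev [seq (a.1, ~~ a.2) | a <- q]) t b
  (rev [seq (a.1, ~~ a.2) | a <- p]).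
Qed.

Let fg_mulA : associative fg_mul.
Proof.
by elim/fgclassW=> x; elim/fgclassW=> y; elim/fgclassW=> z; rewrite !fg_mulE catA.
Qed.
Let fg_mul1 : left_id (fgclass [::]) fg_mul.
Proof. by elim/fgclassW=> x; rewrite fg_mulE. Qed.
Let fg_mulg1 : right_id (fgclass [::]) fg_mul.
Proof. by elim/fgclassW=> x; rewrite fg_mulE cats0. Qed.
Let fg_mulV : left_inverse (fgclass [::]) fg_inv fg_mul.
Proof.
elim/fgclassW=> x; rewrite fg_invE fg_mulE.
elim: x => [//|[t b] x IH]; rewrite /fginvw /= rev_cons -cats1 -catA /= -IH.
apply/fgclassP/rst_step.
by have := FgCancel (fginvw x) t (~~ b) x; rewrite negbK.
Qed.
Let fginvwK : involutive fginvw.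
Proof.
move=> x; rewrite /fginvw map_rev revK -map_comp -[RHS]map_id.
by apply: eq_map => -[t b] /=; rewrite negbK.
Qed.
Let fg_mulgV : right_inverse (fgclass [::]) fg_inv fg_mul.
Proof.
elim/fgclassW=> x; rewrite -{1}[x]fginvwK -fg_invE.
by rewrite -(fg_mulV (fgclass (fginvw x))) !fg_invE fginvwK.
Qed.

HB.instance Definition _ := isGroup.Build freeGroup
  fg_mulA fg_mul1 fg_mulg1 fg_mulV fg_mulgV.

Definition fg_gen (t : T) : freeGroup := fgclass [:: (t, true)].

Section Lift.
Variables (G : groupType) (f : T -> G).

Definition fg_eval (s : fgword) : G :=
  \prod_(a <- s) (if a.2 then f a.1 else (f a.1)^-1).

(* By [fg_liftE] below, this is the ordered product of the f(u_i)^(e_i) for any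
   word u_1^(e_1) ... u_n^(e_n) representing [u]. *)
Definition fg_lift (u : freeGroup) : G := fg_eval (repr u).

Lemma fg_liftE s : fg_lift (fgclass s) = fg_eval s.
Proof.
apply: fgclass_compat; last exact: fgclass_repr.
move=> _ _ [p t b q]; rewrite /fg_eval !big_cat /= !big_cons /=; congr (_ * _).
by case: b => /=; rewrite ?mulKg ?mulVKg.
Qed.

Lemma fg_lift_gen t : fg_lift (fg_gen t) = f t.
Proof. by rewrite fg_liftE /fg_eval big_seq1. Qed.

Lemma fg_liftM : {morph fg_lift : u v / u * v}.
Proof.
elim/fgclassW=> s; elim/fgclassW=> r.
rewrite (_ : _ * _ = fgclass (s ++ r)) ?[LHS]fg_liftE; last exact: fg_mulE.
by rewrite !fg_liftE /fg_eval big_cat.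
Qed.

Lemma fg_lift1 : fg_lift 1 = 1.
Proof. by rewrite [LHS]fg_liftE /fg_eval big_nil. Qed.

Lemma fg_liftV : {morph fg_lift : u / u^-1}.
Proof. by move=> u; apply/esym/mulg1_eq; rewrite -fg_liftM mulgV fg_lift1. Qed.

End Lift.

Lemma fg_ind (Q : freeGroup -> Prop) :
  Q 1 -> (forall t, Q (fg_gen t)) ->
  (forall u v, Q u -> Q v -> Q (u * v)) -> (forall u, Q u -> Q u^-1) ->
  forall u, Q u.
Proof.
move=> Q1 Qg QM QV; elim/fgclassW; elim=> [//|[t b] s IH].
rewrite (_ : fgclass _ = fgclass [:: (t, b)] * fgclass s); last exact/esym/fg_mulE.
apply: QM => //; case: b; first exact: Qg.
rewrite (_ : fgclass _ = (fg_gen t)^-1); first exact/QV/Qg.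
exact/esym/fg_invE.
Qed.

Lemma fg_hom_eq (G : groupType) (g h : freeGroup -> G) :
  {morph g : u v / u * v} -> {morph h : u v / u * v} ->
  (forall t, g (fg_gen t) = h (fg_gen t)) -> g =1 h.
Proof.
move=> gM hM gh.
have m1 (k : freeGroup -> G) : {morph k : u v / u * v} -> k 1 = 1.
  by move=> kM; apply: (@mulgI _ (k 1)); rewrite -kM !mulg1.
have mV (k : freeGroup -> G) : {morph k : u v / u * v} -> {morph k : u / u^-1}.
  by move=> kM u; apply/esym/mulg1_eq; rewrite -kM mulgV m1.
elim/fg_ind=> [|//|u v IHu IHv|u IHu]; first by rewrite !m1.
- by rewrite gM hM IHu IHv.
- by rewrite !mV // IHu.
Qed.

End FreeGroup.

Section WireLemmas.
Variable W : wireType.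
Implicit Types a b c : W.

Lemma circ1r a : circ a 1 = a.
Proof.
apply/esym/(@mulgI _ (circ a 1 * a^-1)).
by rewrite -circMr mulg1 mulgVK.
Qed.

Lemma circ1l a : circ 1 a = a.
Proof.
apply/esym/(@mulgI _ (circ 1 a * a^-1)).
by rewrite -circMl mulg1 mulgVK.
Qed.

End WireLemmas.

(* The two absorption conditions are what makes [circ] compatible with the
   congruence modulo the normal subgroup, see [quotw_circE]. *)
Record wireIdeal (W : wireType) := WireIdeal {
  ideal_normal :> normalSubgroup W;
  ideal_circl : forall a i, ideal_normal i -> ideal_normal (a^-1 * circ a i);
  ideal_circr : forall a i, ideal_normal i -> ideal_normal (circ i a * a^-1)
}.

Section QuotientWire.
Variables (W : wireType) (I : wireIdeal W).

Definition quotw := quotg I.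

HB.instance Definition _ := monoid.Group.on quotw.

Definition quotw_circ (a b : quotw) : quotw := proj I (circ (repr a) (repr b)).

Lemma quotw_circE x y : quotw_circ (proj I x) (proj I y) = proj I (circ x y).
Proof.
rewrite /quotw_circ; set x' := repr _; set y' := repr _.
have /projP Ix : proj I x = proj I x' by rewrite proj_repr.
have /projP Iy : proj I y = proj I y' by rewrite proj_repr.
rewrite -[y'](mulVKg y) circMr -mulgA projM.
rewrite [X in _ * X](proj_eq1 I _).2 ?mulg1; last exact: ideal_circl.
rewrite -[x'](mulVKg x) circMl.
set d := x^-1 * x'; rewrite (_ : _ * _ = circ x y * (circ d y * y^-1) ^ y).
  rewrite [LHS]projM [X in _ * X](proj_eq1 I _).2 ?mulg1 //.
  by have [_] := normal_setP I; apply; apply: ideal_circr.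
by rewrite conjgE !mulgA mulgVK.
Qed.

Let quotw_circA : associative quotw_circ.
Proof.
elim/projW=> x; elim/projW=> y; elim/projW=> z.
by rewrite !quotw_circE circA.
Qed.

Let quotw_circMr (a b c : quotw) :
  quotw_circ a (b * c) = quotw_circ a b * a^-1 * quotw_circ a c.
Proof.
elim/projW: a => x; elim/projW: b => y; elim/projW: c => z.
by rewrite -[proj I y * _]projM !quotw_circE circMr !projM projV.
Qed.

Let quotw_circMl (a b c : quotw) :
  quotw_circ (b * c) a = quotw_circ b a * a^-1 * quotw_circ c a.
Proof.
elim/projW: a => x; elim/projW: b => y; elim/projW: c => z.
by rewrite -[proj I y * _]projM !quotw_circE circMl !projM projV.
Qed.

HB.instance Definition _ := Group_isWire.Build quotw
  quotw_circA quotw_circMr quotw_circMl.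

End QuotientWire.

(* [(x, s)] is the nonempty word [x :: s]. *)
Definition freeSemigroup (X : Type) : Type := (X * seq X)%type.

HB.instance Definition _ (X : Type) := gen_eqMixin (freeSemigroup X).
HB.instance Definition _ (X : Type) := gen_choiceMixin (freeSemigroup X).

Section FreeSemigroup.
Variable X : Type.
Local Notation M := (freeSemigroup X).

Definition letter (x : X) : M := (x, [::]).

Definition mcirc (m l : M) : M := (m.1, m.2 ++ l.1 :: l.2).

Lemma mcircA : associative mcirc.
Proof. by move=> m l k; rewrite /mcirc /= -catA. Qed.

(* The product of the n+1 letters x_0, ..., x_n, in this order. *)
Definition mprod n (x : 'I_n.+1 -> X) : M :=
  foldl (fun m i => mcirc m (letter (x (lift ord0 i)))) (letter (x ord0))
        (enum 'I_n).

Definition mword (m : M) : seq {classic X} := m.1 :: m.2.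

Lemma mword_inj : injective mword.
Proof. by move=> [x s] [y t] [-> ->]. Qed.

Lemma mword_circ m l : mword (mcirc m l) = mword m ++ mword l.
Proof. by []. Qed.

Lemma mword_prod n (x : 'I_n.+1 -> X) : mword (mprod x) = [seq x i | i <- enum 'I_n.+1].
Proof.
rewrite enum_ordSl /= -map_comp /mprod.
have foldE (m : M) (r : seq 'I_n) :
  mword (foldl (fun m i => mcirc m (letter (x (lift ord0 i)))) m r) =
  mword m ++ [seq x (lift ord0 i) | i <- r].
  by elim: r m => [|i r IH] m /=; rewrite ?cats0 // IH mword_circ -catA.
by rewrite foldE.
Qed.

Lemma perm_mprod n (x : 'I_n.+1 -> X) (s : 'S_n.+1) :
  perm_eq (mword (mprod (x \o s))) (mword (mprod x)).
Proof.
rewrite !mword_prod (map_comp x s); apply: (@perm_map _ {classic X}).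
apply: uniq_perm; rewrite ?(map_inj_uniq perm_inj) ?enum_uniq // => i.
by rewrite mem_enum -[i](permKV s) mem_map ?mem_enum //; exact: perm_inj.
Qed.

Lemma perm_mwordP (m l : M) : perm_eq (mword m) (mword l) ->
  exists n (x : 'I_n.+1 -> X) (s : 'S_n.+1), l = mprod x /\ m = mprod (x \o s).
Proof.
move=> pml; case: l pml => y t pml.
pose r : (size t).+1.-tuple {classic X} := in_tuple ((y : {classic X}) :: t).
have /tuple_permP[s ms] : perm_eq (mword m) r by [].
exists (size t), (tnth r), s; split; apply: mword_inj; rewrite mword_prod.
  by rewrite map_tnth_enum.
rewrite ms /=; by apply: eq_map => i.
Qed.

End FreeSemigroup.

Section PX.
Variable X : Type.
Local Notation M := (freeSemigroup X).
Local Notation PX := (freeGroup M).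

Definition pgen (m : M) : PX := fg_gen m.

(* The four operations below are instances of [fg_lift], that is, products over
   the letters of a word representing one of the arguments; [M] and [P] in the
   first two names tell which arguments lie in M(X) and in P(X). *)
Definition circMP (l : M) (u : PX) : PX :=
  pgen l * fg_lift (fun m => (pgen l)^-1 * pgen (mcirc l m)) u.

Definition circPM (u : PX) (l : M) : PX :=
  fg_lift (fun m => pgen (mcirc m l) * (pgen l)^-1) u * pgen l.

Definition circ_r (u v : PX) : PX :=
  fg_lift (fun m => circMP m v * v^-1) u * v.

Definition circ_l (u v : PX) : PX :=
  u * fg_lift (fun m => u^-1 * circPM u m) v.

Definition P2 : set PX :=
  gen_normal [set x | exists m l,
    x = (pgen m)^-1 * pgen (mcirc m l) * (pgen l)^-1].

Definition P2op : set PX :=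
  gen_normal [set x | exists m l,
    x = (pgen m)^-1 * pgen (mcirc l m) * (pgen l)^-1].

Definition comm_P2 : set PX :=
  gen_subgroup [set x | exists a b,
    [/\ P2 a, P2op b & x = a * b * a^-1 * b^-1]].

Definition circ_comm_PX : set PX :=
  gen_normal [set x | exists n (y : 'I_n.+1 -> X) (s : 'S_n.+1),
    x = (pgen (mprod y))^-1 * pgen (mprod (y \o s))].

Lemma circ_comm_PX_is_normal : is_normal circ_comm_PX.
Proof. exact: gen_normal_is_normal. Qed.

End PX.

Section Fw.
Variable X : Type.
Local Notation M := (freeSemigroup X).
Local Notation PX := (freeGroup M).
Implicit Types (u v w : PX) (m l k : M).

Local Ltac gs := rewrite ?(invgM, invgK, invg1, mulgA, mulg1, mul1g, mulgV,
  mulVg, mulgK, mulgVK).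

Definition P2_normal := NormalSubgroup (gen_normal_is_normal _ : is_normal (@P2 X)).
Definition P2op_normal :=
  NormalSubgroup (gen_normal_is_normal _ : is_normal (@P2op X)).
Local Notation N2 := P2_normal.
Local Notation N2op := P2op_normal.

Let lift_conj (N : normalSubgroup PX) (f : M -> PX) (g u : PX) :
  (forall m, proj N (f m) = proj N (pgen m ^ g)) ->
  proj N (fg_lift f u) = proj N (u ^ g).
Proof.
move=> fE.
apply: (fg_hom_eq (g := proj N \o fg_lift f) (h := proj N \o conjg^~ g)).
- by move=> a b /=; rewrite fg_liftM projM.
- by move=> a b /=; rewrite conjMg projM.
- by move=> m /=; rewrite fg_lift_gen fE.
Qed.

Let lift_id (N : normalSubgroup PX) (f : M -> PX) (u : PX) :
  (forall m, proj N (f m) = proj N (pgen m)) ->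
  proj N (fg_lift f u) = proj N u.
Proof. by move=> fE; rewrite (lift_conj (g := 1)) ?conjg1 // => m; rewrite conjg1. Qed.

Let N2_circ m l : proj N2 (pgen (mcirc m l)) = proj N2 (pgen m * pgen l).
Proof.
apply/esym/projP; rewrite (_ : _ * _ =
  ((pgen m)^-1 * pgen (mcirc m l) * (pgen l)^-1) ^ pgen l).
  by apply: gen_normalJ; apply: sub_gen_smallest; exists m, l.
by rewrite conjgE; gs.
Qed.

Let N2op_circ m l : proj N2op (pgen (mcirc l m)) = proj N2op (pgen m * pgen l).
Proof.
apply/esym/projP; rewrite (_ : _ * _ =
  ((pgen m)^-1 * pgen (mcirc l m) * (pgen l)^-1) ^ pgen l).
  by apply: gen_normalJ; apply: sub_gen_smallest; exists m, l.
by rewrite conjgE; gs.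
Qed.

Let N2_circPM u l : proj N2 (circPM u l) = proj N2 (u * pgen l).
Proof.
rewrite 2!projM; congr (_ * _); apply: lift_id => m.
by rewrite projM N2_circ -projM; gs.
Qed.

Let N2_circMP l u : proj N2 (circMP l u) = proj N2 (pgen l * u).
Proof.
rewrite 2!projM; congr (_ * _); apply: lift_id => m.
by rewrite projM N2_circ -projM; gs.
Qed.

Let N2_circ_r u v : proj N2 (circ_r u v) = proj N2 (u * v).
Proof.
rewrite 2!projM; congr (_ * _); apply: lift_id => m.
by rewrite projM N2_circMP -projM; gs.
Qed.

Let N2_circ_l u v : proj N2 (circ_l u v) = proj N2 (u * v).
Proof.
rewrite 2!projM; congr (_ * _); apply: lift_id => m.
by rewrite projM N2_circPM -projM; gs.
Qed.

Let N2op_circPM u l : proj N2op (circPM u l) = proj N2op (pgen l * u).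
Proof.
rewrite projM (lift_conj (g := (pgen l)^-1)).
  by rewrite -projM conjgE; gs.
by move=> m; rewrite projM N2op_circ -projM conjgE; gs.
Qed.

Let N2op_circMP l u : proj N2op (circMP l u) = proj N2op (u * pgen l).
Proof.
rewrite projM (lift_conj (g := pgen l)).
  by rewrite -projM conjgE; gs.
by move=> m; rewrite projM N2op_circ -projM conjgE; gs.
Qed.

Let N2op_circ_r u v : proj N2op (circ_r u v) = proj N2op (v * u).
Proof.
rewrite projM (lift_conj (g := v^-1)).
  by rewrite -projM conjgE; gs.
by move=> m; rewrite projM N2op_circMP -projM conjgE; gs.
Qed.

Let N2op_circ_l u v : proj N2op (circ_l u v) = proj N2op (v * u).
Proof.
rewrite projM (lift_conj (g := u)).
  by rewrite -projM conjgE; gs.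
by move=> m; rewrite projM N2op_circPM -projM conjgE; gs.
Qed.

Lemma comm_P2_is_normal : is_normal (@comm_P2 X).
Proof.
split=> [|x g Dx]; first exact: gen_subgroup_is_subgroup.
apply: (Dx [set x | comm_P2 (x ^ g)]); split=> /= [|_ [a [b [Pa Pb ->]]]].
  split=> /= [|y z Dy Dz|y Dy] /=; rewrite ?conj1g ?conjMg ?conjVg //.
  - exact: gen_subgroup1.
  - exact: gen_subgroupM Dy Dz.
  - exact: gen_subgroupV Dy.
apply: sub_gen_smallest; exists (a ^ g), (b ^ g).
split; try exact: gen_normalJ.
by rewrite !conjMg !conjVg.
Qed.

Definition comm_P2_normal := NormalSubgroup comm_P2_is_normal.

Local Notation D := comm_P2_normal.

Let D_comm a b : P2 a -> P2op b -> proj D (a * b) = proj D (b * a).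
Proof.
move=> Pa Pb; apply/projP; rewrite invgM -{2}[b]invgK.
rewrite (_ : _ * _ = (b^-1 * a^-1 * b * a)); last by gs.
rewrite (_ : _ * a = (a^-1 * b^-1 * a^-1^-1 * b^-1^-1)^-1); last by gs.
apply: gen_subgroupV; apply: sub_gen_smallest; exists a^-1, b^-1; split => //; exact: gen_normalV.
Qed.

Let circ_lE u v : circ_l u v = u * fg_lift (fun m => u^-1 * circPM u m) v.
Proof. by []. Qed.

Let circ_rE u v : circ_r u v = fg_lift (fun m => circMP m v * v^-1) u * v.
Proof. by []. Qed.

Let circ_lM u v w : circ_l u (v * w) = circ_l u v * u^-1 * circ_l u w.
Proof. by rewrite !circ_lE fg_liftM; gs. Qed.

Let circ_lV u v : circ_l u v^-1 = u * (circ_l u v)^-1 * u.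
Proof. by rewrite !circ_lE fg_liftV; gs. Qed.

Let circ_rM u v w : circ_r (v * w) u = circ_r v u * u^-1 * circ_r w u.
Proof. by rewrite !circ_rE fg_liftM; gs. Qed.

Let circ_rV u v : circ_r v^-1 u = u * (circ_r v u)^-1 * u.
Proof. by rewrite !circ_rE fg_liftV; gs. Qed.

Let circ_l1 u : circ_l u 1 = u.
Proof. by rewrite circ_lE fg_lift1; gs. Qed.

Let circ_r1 u : circ_r 1 u = u.
Proof. by rewrite circ_rE fg_lift1; gs. Qed.

Let circ_l_gen u m : circ_l u (pgen m) = circPM u m.
Proof. by rewrite circ_lE fg_lift_gen; gs. Qed.

Let circ_r_gen m v : circ_r (pgen m) v = circMP m v.
Proof. by rewrite circ_rE fg_lift_gen; gs. Qed.

Let circPM_gen m l : circPM (pgen m) l = pgen (mcirc m l).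
Proof. by rewrite /circPM fg_lift_gen; gs. Qed.

Let circMP_gen m l : circMP l (pgen m) = pgen (mcirc l m).
Proof. by rewrite /circMP fg_lift_gen; gs. Qed.

Let circPM1 m : circPM 1 m = pgen m.
Proof. by rewrite /circPM fg_lift1; gs. Qed.

Let circPMM u v m : circPM (u * v) m = circPM u m * (pgen m)^-1 * circPM v m.
Proof. by rewrite /circPM fg_liftM; gs. Qed.

Let circ_l_gen_l m v : circ_l (pgen m) v = circMP m v.
Proof.
rewrite circ_lE /circMP; congr (_ * _).
apply: fg_hom_eq; try exact: fg_liftM.
by move=> l; rewrite !fg_lift_gen circPM_gen.
Qed.

Let circ_l_1l v : circ_l 1 v = v.
Proof.
rewrite circ_lE mul1g.
apply: (fg_hom_eq (h := id)) => //; first exact: fg_liftM.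
by move=> l; rewrite fg_lift_gen circPM1; gs.
Qed.

Local Ltac gs' := repeat match goal with
  | |- context [circ_l ?a ?b] => move: (circ_l a b) => ?
  | |- context [circ_r ?a ?b] => move: (circ_r a b) => ?
  end; gs.

Let Pj1 (N : normalSubgroup PX) x : proj N x = proj N 1 -> N x.
Proof. by move/proj_eq1. Qed.

Let pM (N : normalSubgroup PX) x x' y y' :
  proj N x = proj N x' -> proj N y = proj N y' -> proj N (x * y) = proj N (x' * y').
Proof. by rewrite [proj N (x * y)]projM => -> ->; rewrite -projM. Qed.

Let pV (N : normalSubgroup PX) x x' :
  proj N x = proj N x' -> proj N x^-1 = proj N x'^-1.
Proof. by rewrite projV => ->; rewrite -projV. Qed.

Let D_comm4 x a b y : P2 a -> P2op b ->
  proj D (x * (b * a) * y) = proj D (x * (a * b) * y).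
Proof. by move=> Pa Pb; apply: pM => //; apply: pM => //; apply/esym; exact: D_comm. Qed.

Let circ_l_Ml u v w :
  proj D (circ_l (u * v) w) = proj D (circ_l u w * w^-1 * circ_l v w).
Proof.
elim/fg_ind: w => [|m|w1 w2 IH1 IH2|w IH].
- by rewrite !circ_l1; gs'.
- by rewrite !circ_l_gen circPMM.
- pose a := u^-1 * circ_l u w2 * w2^-1; pose b := w1^-1 * circ_l v w1 * v^-1.
  have Pa : P2 a.
    rewrite /a; have := N2_circ_l u w2; move: (circ_l u w2) => c E.
    by apply: (Pj1 (N := N2)); rewrite !(projM, projV) E !projM /=; gs'.
  have Pb : P2op b.
    rewrite /b; have := N2op_circ_l v w1; move: (circ_l v w1) => c E.
    by apply: (Pj1 (N := N2op)); rewrite !(projM, projV) E !projM /=; gs'.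
  rewrite circ_lM.
  transitivity (proj D (circ_l u w1 * (b * a) * circ_l v w2)).
    rewrite (_ : circ_l u w1 * _ * _ =
      circ_l u w1 * w1^-1 * circ_l v w1 * (u * v)^-1 *
      (circ_l u w2 * w2^-1 * circ_l v w2)); last by rewrite /a /b; gs'.
    by apply: pM => //; apply: pM.
  by rewrite D_comm4 // !circ_lM; congr proj; rewrite /a /b; gs'.
- pose a := (circ_l u w)^-1 * u * w; pose b := v * (circ_l v w)^-1 * w.
  have Pa : P2 a.
    rewrite /a; have := N2_circ_l u w; move: (circ_l u w) => c E.
    by apply: (Pj1 (N := N2)); rewrite !(projM, projV) E !projM /=; gs'.
  have Pb : P2op b.
    rewrite /b; have := N2op_circ_l v w; move: (circ_l v w) => c E.
    by apply: (Pj1 (N := N2op)); rewrite !(projM, projV) E !projM /=; gs'.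
  rewrite circ_lV.
  transitivity (proj D (u * (b * a) * (w^-1 * v))).
    rewrite (_ : u * (b * a) * _ =
      u * v * (circ_l u w * w^-1 * circ_l v w)^-1 * (u * v)); last first.
      by rewrite /a /b; gs'.
    by apply: pM => //; apply: pM => //; apply: pV.
  by rewrite D_comm4 // !circ_lV; congr proj; rewrite /a /b; gs'.
Qed.

Lemma circ_lr u v : proj D (circ_l u v) = proj D (circ_r u v).
Proof.
elim/fg_ind: u v => [|m|u1 u2 IH1 IH2|u IH] v.
- by rewrite circ_l_1l circ_r1.
- by rewrite circ_l_gen_l circ_r_gen.
- rewrite circ_l_Ml circ_rM; apply: (pM _ (IH2 v)); exact: (pM (IH1 v)).

- have := circ_l_Ml u u^-1 v; rewrite mulgV circ_l_1l circ_rV => E.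
  rewrite (_ : circ_l _ _ =
    v * (circ_l u v)^-1 * (circ_l u v * v^-1 * circ_l u^-1 v)); last by gs'.
  apply: (pM _ (esym E)); apply: pM => //; apply: pV; exact: IH.
Qed.

Let circ_l_D u d : D d -> D (u^-1 * circ_l u d).
Proof.
apply: (smallest_sub (X := [set d | D (u^-1 * circ_l u d)])); first split=> /=.
- by rewrite circ_l1 mulVg; exact: gen_subgroup1.
- move=> x y Dx Dy; rewrite circ_lM.
  have -> : u^-1 * (circ_l u x * u^-1 * circ_l u y) =
    (u^-1 * circ_l u x) * (u^-1 * circ_l u y) by gs'.
  exact: gen_subgroupM.
- move=> x Dx; rewrite circ_lV.
  have -> : u^-1 * (u * (circ_l u x)^-1 * u) = (u^-1 * circ_l u x)^-1 by gs'.
  exact: gen_subgroupV.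
move=> _ [a [b [Pa Pb ->]]] /=.
apply: sub_gen_smallest; exists (u^-1 * circ_l u a), (u^-1 * circ_l u b); split.
- apply: (Pj1 (N := N2)); transitivity (proj N2 a); last exact/proj_eq1.
  have := N2_circ_l u a; move: (circ_l u a) => c E.
  by rewrite projM E -projM; gs'.
- apply: (Pj1 (N := N2op)); transitivity (proj N2op (u^-1 * b * u)).
    have := N2op_circ_l u b; move: (circ_l u b) => c E.
    by rewrite projM E -projM; gs'.
  by apply/proj_eq1; rewrite -mulgA; apply: gen_normalJ.
- by rewrite !circ_lM !circ_lV; gs'.
Qed.

Let circ_r_D u d : D d -> D (circ_r d u * u^-1).
Proof.
apply: (smallest_sub (X := [set d | D (circ_r d u * u^-1)])); first split=> /=.
- by rewrite circ_r1 mulgV; exact: gen_subgroup1.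
- move=> x y Dx Dy; rewrite circ_rM.
  have -> : circ_r x u * u^-1 * circ_r y u * u^-1 =
    (circ_r x u * u^-1) * (circ_r y u * u^-1) by gs'.
  exact: gen_subgroupM.
- move=> x Dx; rewrite circ_rV.
  have -> : u * (circ_r x u)^-1 * u * u^-1 = (circ_r x u * u^-1)^-1 by gs'.
  exact: gen_subgroupV.
move=> _ [a [b [Pa Pb ->]]] /=.
apply: sub_gen_smallest; exists (circ_r a u * u^-1), (circ_r b u * u^-1); split.
- apply: (Pj1 (N := N2)); transitivity (proj N2 a); last exact/proj_eq1.
  have := N2_circ_r a u; move: (circ_r a u) => c E.
  by rewrite projM E -projM; gs'.
- apply: (Pj1 (N := N2op)); transitivity (proj N2op (u * b * u^-1)).
    have := N2op_circ_r b u; move: (circ_r b u) => c E.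
    by rewrite projM E -projM; gs'.
  by apply/proj_eq1; rewrite -{1}[u]invgK -mulgA; apply: gen_normalJ.
- by rewrite !circ_rM !circ_rV; gs'.
Qed.

Lemma circ_l_compat u u' v v' : proj D u = proj D u' -> proj D v = proj D v' ->
  proj D (circ_l u v) = proj D (circ_l u' v').
Proof.
move=> /projP Du /projP Dv; transitivity (proj D (circ_l u v')).
  apply/projP; rewrite -[v'](mulVKg v) circ_lM.
  have -> : (circ_l u v)^-1 * (circ_l u v * u^-1 * circ_l u (v^-1 * v')) =
    u^-1 * circ_l u (v^-1 * v') by gs'.
  exact: circ_l_D.
rewrite !circ_lr; apply/projP; rewrite -[u'](mulVKg u) circ_rM.
have -> : (circ_r u v')^-1 * (circ_r u v' * v'^-1 * circ_r (u^-1 * u') v') =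
  (circ_r (u^-1 * u') v' * v'^-1) ^ v' by rewrite conjgE; gs'.
by apply: comm_P2_is_normal.2; apply: circ_r_D.
Qed.

Definition Fw := quotg D.

HB.instance Definition _ := monoid.Group.on Fw.

(* [Fw_circ_lE] and [Fw_circ_rE] show that the choice of representatives and of
   [circ_l] rather than [circ_r] is immaterial. *)
Definition Fw_circ (a b : Fw) : Fw := proj D (circ_l (repr a) (repr b)).

Lemma Fw_circ_lE u v : Fw_circ (proj D u) (proj D v) = proj D (circ_l u v).
Proof. by apply: circ_l_compat; rewrite proj_repr. Qed.

Lemma Fw_circ_rE u v : Fw_circ (proj D u) (proj D v) = proj D (circ_r u v).
Proof. by rewrite Fw_circ_lE circ_lr. Qed.

Local Ltac gs'' := repeat match goal with
  | |- context [Fw_circ ?a ?b] => move: (Fw_circ a b) => ?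
  end; gs.

Let Fw_circMr (a b c : Fw) : Fw_circ a (b * c) = Fw_circ a b * a^-1 * Fw_circ a c.
Proof.
elim/projW: a => u; elim/projW: b => v; elim/projW: c => w.
rewrite -[proj D v * _]projM !Fw_circ_lE circ_lM.
by rewrite [LHS]projM [proj D (_ * u^-1)]projM projV.
Qed.

Let Fw_circMl (a b c : Fw) : Fw_circ (b * c) a = Fw_circ b a * a^-1 * Fw_circ c a.
Proof.
elim/projW: a => u; elim/projW: b => v; elim/projW: c => w.
rewrite -[proj D v * _]projM !Fw_circ_rE circ_rM.
by rewrite [LHS]projM [proj D (_ * u^-1)]projM projV.
Qed.

Let Fw_circ1 a : Fw_circ a 1 = a.
Proof. by elim/projW: a => u; rewrite -[1]/(proj D 1) Fw_circ_lE circ_l1. Qed.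

Let Fw_1circ a : Fw_circ 1 a = a.
Proof. by elim/projW: a => u; rewrite -[1]/(proj D 1) Fw_circ_rE circ_r1. Qed.

Let Fw_circVr a b : Fw_circ a b^-1 = a * (Fw_circ a b)^-1 * a.
Proof.
have := Fw_circMr a b b^-1; rewrite mulgV Fw_circ1.
by move: (Fw_circ a b) (Fw_circ a b^-1) => c d E; rewrite -[d](mulKg (c * a^-1)) -E; gs.
Qed.

Let Fw_circVl a b : Fw_circ b^-1 a = a * (Fw_circ b a)^-1 * a.
Proof.
have := Fw_circMl a b b^-1; rewrite mulgV Fw_1circ.
by move: (Fw_circ b a) (Fw_circ b^-1 a) => c d E; rewrite -[d](mulKg (c * a^-1)) -E; gs.
Qed.

Let Fw_ind (Q : Fw -> Prop) : Q 1 -> (forall m, Q (proj D (pgen m))) ->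
  (forall a b, Q a -> Q b -> Q (a * b)) -> (forall a, Q a -> Q a^-1) ->
  forall a, Q a.
Proof.
move=> Q1 Qg QM QV; elim/projW; elim/fg_ind => [//|//|u v Qu Qv|u Qu].
  by rewrite [proj _ _]projM; apply: QM.
by rewrite [proj _ _]projV; apply: QV.
Qed.

Let Fw_circ_gen m l :
  Fw_circ (proj D (pgen m)) (proj D (pgen l)) = proj D (pgen (mcirc m l)).
Proof. by rewrite Fw_circ_lE circ_l_gen circPM_gen. Qed.

Let Fw_circA : associative Fw_circ.
Proof.
move=> a b c; elim/Fw_ind: c a b => [a b|k a b|c d IHc IHd a b|c IH a b].
- by rewrite !Fw_circ1.
- elim/Fw_ind: b a => [a|l|b c IHb IHc a|b IH a].
  + by rewrite Fw_1circ Fw_circ1.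
  + elim/Fw_ind=> [|m|a b IHa IHb|a IH].
    * by rewrite !Fw_1circ.
    * by rewrite !Fw_circ_gen mcircA.
    * by rewrite !(Fw_circMl, Fw_circVl) IHa IHb; gs''.
    * by rewrite !(Fw_circMl, Fw_circVl) IH; gs''.
  + by rewrite !(Fw_circMl, Fw_circMr, Fw_circVr, Fw_circVl) IHb IHc; gs''.
  + by rewrite !(Fw_circMl, Fw_circMr, Fw_circVr, Fw_circVl) IH; gs''.
- by rewrite !(Fw_circMr, Fw_circVr) IHc IHd; gs''.
- by rewrite !(Fw_circMr, Fw_circVr) IH; gs''.
Qed.

HB.instance Definition _ := Group_isWire.Build Fw Fw_circA Fw_circMr Fw_circMl.

Definition circ_comm_Fw : set Fw :=
  [set x | exists a b, [/\ circ_comm_PX a, comm_P2 b & x = proj D (a * b)]].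

Let circ_comm_FwP x :
  circ_comm_Fw x <-> exists2 a, circ_comm_PX a & x = proj D a.
Proof.
split=> [[a [b [Ca Db ->]]]|[a Ca ->]].
  exists a => //; rewrite [LHS]projM [X in _ * X](_ : _ = 1) ?mulg1 //.
  exact/proj_eq1.
by exists a, 1; split; rewrite ?mulg1 //; apply: gen_subgroup1.
Qed.

Lemma circ_comm_Fw_is_normal : is_normal circ_comm_Fw.
Proof.
have [[C1 CM CV] CJ] := circ_comm_PX_is_normal X.
split=> [|_ + /circ_comm_FwP[a Ca ->]].
  split=> [|_ _ /circ_comm_FwP[a Ca ->] /circ_comm_FwP[b Cb ->]|
    _ /circ_comm_FwP[a Ca ->]]; apply/circ_comm_FwP.
  - by exists 1.
  - by exists (a * b); [apply: CM|rewrite projM].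
  - by exists a^-1; [apply: CV|rewrite projV].
elim/projW=> g; apply/circ_comm_FwP; exists (a ^ g); first exact: CJ.
by rewrite !conjgE !projM projV.
Qed.

Local Notation C := (NormalSubgroup (circ_comm_PX_is_normal X)).

Let C_perm m l : perm_eq (mword m) (mword l) -> proj C (pgen m) = proj C (pgen l).
Proof.
move=> /perm_mwordP[n [x [s [-> ->]]]]; apply/esym/projP.
by apply: sub_gen_smallest; exists n, x, s.
Qed.

Let C_circPM u m l : perm_eq (mword m) (mword l) ->
  proj C (circPM u m) = proj C (circPM u l).
Proof.
move=> pml; rewrite /circPM; apply: pM; last exact: C_perm.
apply: (fg_hom_eq (g := proj C \o fg_lift _) (h := proj C \o fg_lift _)).
- by move=> a b /=; rewrite fg_liftM projM.
- by move=> a b /=; rewrite fg_liftM projM.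
- move=> k /=; rewrite !fg_lift_gen; apply: pM; last by apply: pV; exact: C_perm.
  by apply: C_perm; rewrite !mword_circ perm_cat2l.
Qed.

Let C_circMP u m l : perm_eq (mword m) (mword l) ->
  proj C (circMP m u) = proj C (circMP l u).
Proof.
move=> pml; rewrite /circMP; apply: pM; first exact: C_perm.
apply: (fg_hom_eq (g := proj C \o fg_lift _) (h := proj C \o fg_lift _)).
- by move=> a b /=; rewrite fg_liftM projM.
- by move=> a b /=; rewrite fg_liftM projM.
- move=> k /=; rewrite !fg_lift_gen; apply: pM; first by apply: pV; exact: C_perm.
  by apply: C_perm; rewrite !mword_circ perm_cat2r.
Qed.

Let C_circ_l u d : C d -> C (u^-1 * circ_l u d).
Proof.
have [[C1 CM CV] CJ] := circ_comm_PX_is_normal X.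
have LM x y : u^-1 * circ_l u (x * y) = (u^-1 * circ_l u x) * (u^-1 * circ_l u y).
  by rewrite circ_lM; gs'.
have LV x : u^-1 * circ_l u x^-1 = (u^-1 * circ_l u x)^-1.
  by rewrite circ_lV; gs'.
apply: (smallest_sub (X := [set d | C (u^-1 * circ_l u d)])).
  split=> [|x g] /=; last first.
    move=> Cx; rewrite conjgE !LM LV; exact: CJ.
  split=> /= [|x y Cx Cy|x Cx]; first by rewrite circ_l1 mulVg.
  - by rewrite LM; apply: CM.
  - by rewrite LV; apply: CV.
move=> _ [n [y [s ->]]] /=; rewrite LM LV !circ_l_gen.
have /projP := C_circPM u (perm_mprod y s).
move=> /CV; move: (circPM u (mprod y)) (circPM u (mprod (y \o s))) => b a.
by rewrite (_ : (a^-1 * b)^-1 = (u^-1 * b)^-1 * (u^-1 * a)) //; gs.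
Qed.

Let C_circ_r u d : C d -> C (circ_r d u * u^-1).
Proof.
have [[C1 CM CV] CJ] := circ_comm_PX_is_normal X.
have LM x y : circ_r (x * y) u * u^-1 = (circ_r x u * u^-1) * (circ_r y u * u^-1).
  by rewrite circ_rM; gs'.
have LV x : circ_r x^-1 u * u^-1 = (circ_r x u * u^-1)^-1.
  by rewrite circ_rV; gs'.
apply: (smallest_sub (X := [set d | C (circ_r d u * u^-1)])).
  split=> [|x g] /=; last first.
    move=> Cx; rewrite conjgE !LM LV; exact: CJ.
  split=> /= [|x y Cx Cy|x Cx]; first by rewrite circ_r1 mulgV.
  - by rewrite LM; apply: CM.
  - by rewrite LV; apply: CV.
move=> _ [n [y [s ->]]] /=; rewrite LM LV !circ_r_gen.
have /projP := C_circMP u (perm_mprod y s).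
move=> /CV; move: (circMP (mprod y) u) (circMP (mprod (y \o s)) u) => b a.
move/(CJ _ u^-1).
by rewrite (_ : (a^-1 * b)^-1 ^ u^-1 = (b * u^-1)^-1 * (a * u^-1)) //; rewrite conjgE; gs.
Qed.

Let circ_comm_Fw_circl (a i : Fw) :
  circ_comm_Fw i -> circ_comm_Fw (a^-1 * circ a i).
Proof.
elim/projW: a => u /circ_comm_FwP[d Cd ->]; apply/circ_comm_FwP.
exists (u^-1 * circ_l u d); first exact: C_circ_l.
by rewrite projM projV -Fw_circ_lE.
Qed.

Let circ_comm_Fw_circr (a i : Fw) :
  circ_comm_Fw i -> circ_comm_Fw (circ i a * a^-1).
Proof.
elim/projW: a => u /circ_comm_FwP[d Cd ->]; apply/circ_comm_FwP.
exists (circ_r d u * u^-1); first exact: C_circ_r.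
by rewrite projM projV -Fw_circ_rE.
Qed.

Definition circ_comm_ideal : wireIdeal Fw := @WireIdeal Fw
  (NormalSubgroup circ_comm_Fw_is_normal) circ_comm_Fw_circl circ_comm_Fw_circr.

Definition Fcw : wireType := quotw circ_comm_ideal.

Definition Fcw_gen (x : X) : Fcw :=
  proj circ_comm_ideal (proj comm_P2_normal (pgen (letter x))).

End Fw.

(* Main.v *)
From HB Require Import structures.
From mathcomp Require Import all_boot perm.
From mathcomp Require Import boolp classical_sets.
Require Import Defs.

Set Implicit Arguments.
Unset Strict Implicit.
Unset Printing Implicit Defensive.

Local Open Scope group_scope.

(** Expanding (a * b) o (c * d) in two ways shows that in every wire the elements
    a^-1 * (a o d) * d^-1 commute with the elements c^-1 * (b o c) * b^-1.  The
    centraliser of the latter is normal, and so is its own centraliser; hence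
    the group morphism from P(X) to a wire extending a given map on X kills
    [P(X)^2, P(X)^2_op].  If the wire is commutative it kills the circle
    commutators as well, because a product of letters in a commutative monoid
    does not depend on their order; so it factors through F_cw(X).
    Commutativity of F_cw(X) and uniqueness only have to be checked on words,
    since both distributive laws propagate from a generating set to the group
    it generates. *)

Local Ltac gsimpl := rewrite ?(invgM, invgK, invg1, mulgA, mulg1, mul1g, mulgV,
  mulVg, mulgK, mulgVK).

(** * Normality of centralisers and of normal closures *)

Section Centralisers.
Variable G : groupType.
Implicit Types (A : set G) (x y g : G).

Definition centraliser A : set G := fun x => forall y, A y -> commute x y.

Lemma centraliser_is_subgroup A : is_subgroup (centraliser A).
Proof.
split=> [y _|x x' cx cx' y Ay|x cx y Ay]; first exact/commute_sym/commute1.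
- by apply/commute_sym/commuteM; apply/commute_sym; [apply: cx|apply: cx'].
- by apply/commute_sym/commuteV/commute_sym/cx.
Qed.

(** [x ^ g] commutes with [y] exactly when [x] commutes with [y ^ g^-1]. *)
Lemma centraliser_is_normal A :
  (forall x y g, centraliser A x -> A y -> commute x (y ^ g)) ->
  is_normal (centraliser A).
Proof.
move=> AJ; split=> [|x g cx y Ay]; first exact: centraliser_is_subgroup.
have /(congr1 (conjg^~ g)) /= := AJ _ _ g^-1 cx Ay.
by rewrite (conjMg x) (conjMg _ x) conjgKV.
Qed.

Lemma gen_normal_sub A (N : set G) :
  is_normal N -> (forall x, A x -> N x) -> forall x, gen_normal A x -> N x.
Proof. by move=> nN AN x; apply: smallest_sub. Qed.

End Centralisers.

(** * Kernels of group morphisms and factorisation through quotients *)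

Section GroupMorphism.
Variables (G H : groupType) (h : G -> H).
Hypothesis hM : {morph h : x y / x * y}.

Lemma morph_g1 : h 1 = 1.
Proof. by apply: (@mulgI _ (h 1)); rewrite -hM !mulg1. Qed.

Lemma morph_gV : {morph h : x / x^-1}.
Proof. by move=> x; apply/esym/mulg1_eq; rewrite -hM mulgV morph_g1. Qed.

Lemma preim_is_normal (N : set H) : is_normal N -> is_normal (h @^-1` N)%classic.
Proof.
move=> [[N1 NM NV] NJ]; split; first split=> /=.
- by rewrite /preimage /= morph_g1.
- by move=> x y; rewrite /preimage /= hM; apply: NM.
- by move=> x; rewrite /preimage /= morph_gV; apply: NV.
- by move=> x g; rewrite /preimage /= !conjgE !hM morph_gV -conjgE; apply: NJ.
Qed.

Lemma ker_is_normal : is_normal (h @^-1` [set 1])%classic.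
Proof.
apply: preim_is_normal; split; first split=> //=.
- by move=> x y -> ->; rewrite mulg1.
- by move=> x ->; rewrite invg1.
- by move=> x g ->; rewrite conj1g.
Qed.

(** This makes maps defined on a quotient through [repr] independent of the representative. *)
Lemma ker_repr (N : normalSubgroup G) : (forall x, N x -> h x = 1) ->
  forall x, h (repr (proj N x)) = h x.
Proof.
move=> N1 x; have /projP/N1 : proj N (repr (proj N x)) = proj N x.
  exact: proj_repr.
by rewrite hM morph_gV => /(canRL (mulVKg _)); rewrite mulg1.
Qed.

End GroupMorphism.

(** * Commutation relations valid in every wire *)

Section WireTheory.
Variable W : wireType.
Implicit Types a b c d x : W.

(* The shapes of the images in [W] of the generators of P(X)^2 and P(X)^2_op. *)
Definition circ_defect a b := a^-1 * circ a b * b^-1.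
Definition circ_defect_op a b := a^-1 * circ b a * b^-1.

Lemma circ_defect_commute a d c b :
  commute (circ_defect a d) (circ_defect_op c b).
Proof.
(* Both sides equal [circ (a * b) (c * d)]: the left one splits [c * d] first, the right one
   [a * b]. *)
have E : circ a c * c^-1 * circ b c * (b^-1 * a^-1) *
           (circ a d * d^-1 * circ b d) =
         circ a c * a^-1 * circ a d * (d^-1 * c^-1) *
           (circ b c * b^-1 * circ b d).
  by rewrite -!invgM -!circMl -!circMr -circMl.
apply: (mulgI (circ a c)); apply: (mulIg (circ b d)).
by rewrite /circ_defect /circ_defect_op !mulgA; move: E; rewrite !mulgA => ->.
Qed.

Definition circ_defect_op_centraliser : set W :=
  centraliser [set y | exists c b, y = circ_defect_op c b]%classic.

Lemma circ_defect_op_centraliser_is_normal :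
  is_normal circ_defect_op_centraliser.
Proof.
apply: centraliser_is_normal => x _ g cx [c [b ->]].
(* Expanding [circ (g^-1 * b) c] writes the conjugate as a quotient of two elements of the same
   shape. *)
suff -> : circ_defect_op c b ^ g =
    (circ_defect_op c g^-1)^-1 * circ_defect_op c (g^-1 * b).
  by apply: commuteM; [apply: commuteV|]; apply: cx; eexists _, _.
by rewrite /circ_defect_op circMl conjgE; gsimpl.
Qed.

Lemma circ_defect_op_bicentraliser_is_normal :
  is_normal (centraliser circ_defect_op_centraliser).
Proof.
apply: centraliser_is_normal => x y g cx cy; apply: cx.
exact: circ_defect_op_centraliser_is_normal.2.
Qed.

Lemma circVr a b : circ a b^-1 = a * (circ a b)^-1 * a.
Proof.
have := circMr a b b^-1; rewrite mulgV circ1r => E.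
by apply: (mulgI (circ a b * a^-1)); rewrite -E; gsimpl.
Qed.

Lemma circVl a b : circ b^-1 a = a * (circ b a)^-1 * a.
Proof.
have := circMl a b b^-1; rewrite mulgV circ1l => E.
by apply: (mulgI (circ b a * a^-1)); rewrite -E; gsimpl.
Qed.

(** [circMl] and [circMr] expand to the same formula up to swapping the arguments of [circ], so
    commutation survives products and inverses in each argument. *)
Lemma fg_commutative_circ (T : choiceType) (q : freeGroup T -> W) :
  {morph q : u v / u * v} ->
  (forall s t, circ (q (fg_gen s)) (q (fg_gen t)) =
               circ (q (fg_gen t)) (q (fg_gen s))) ->
  forall u v, circ (q u) (q v) = circ (q v) (q u).
Proof.
move=> qM qC; have q1 := morph_g1 qM; have qV := morph_gV qM.
elim/fg_ind=> [|s|u u' IH IH'|u IH] v; first by rewrite q1 circ1l circ1r.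
- elim/fg_ind: v => [|t|v v' IH IH'|v IH]; first by rewrite q1 circ1l circ1r.
  + exact: qC.
  + by rewrite qM circMl circMr IH IH'.
  + by rewrite qV circVl circVr IH.
- by rewrite qM circMl circMr IH IH'.
- by rewrite qV circVl circVr IH.
Qed.

(** The group unit is also neutral for [circ], so it can serve as the default value. *)
Definition word_eval (X : Type) (f : X -> W) (m : freeSemigroup X) : W :=
  \big[circ/1]_(x <- mword m) f x.

End WireTheory.

(** * Extension of a map on X to P(X), F_w(X) and F_cw(X) *)

Section Extension.
Variables (X : Type) (W : wireType) (f : X -> W).
Local Notation PX := (freeGroup (freeSemigroup X)).

HB.instance Definition _ := Monoid.isLaw.Build W 1 (@circ W)
  (@circA W) (@circ1l W) (@circ1r W).

Lemma word_eval_letter x : word_eval f (letter x) = f x.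
Proof. exact: big_seq1. Qed.

Lemma word_eval_circ m l :
  word_eval f (mcirc m l) = circ (word_eval f m) (word_eval f l).
Proof. by rewrite /word_eval mword_circ big_cat. Qed.

Lemma word_eval_perm m l : commutative_wire W ->
  perm_eq (mword m) (mword l) -> word_eval f m = word_eval f l.
Proof.
move=> cW pml.
(* Commutativity is only a hypothesis on [W], so the commutative law is packed locally. *)
pose L : Monoid.com_law (1 : W) := HB.pack (@circ W)
  (SemiGroup.isCommutativeLaw.Build W (@circ W) cW).
exact: (perm_big (op := L) _ pml).
Qed.

Definition PX_eval : PX -> W := fg_lift (word_eval f).

Lemma PX_evalM : {morph PX_eval : u v / u * v}.
Proof. exact: fg_liftM. Qed.

Lemma PX_eval1 : PX_eval 1 = 1.
Proof. exact: fg_lift1. Qed.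

Lemma PX_evalV : {morph PX_eval : u / u^-1}.
Proof. exact: fg_liftV. Qed.

Lemma PX_eval_gen m : PX_eval (pgen m) = word_eval f m.
Proof. exact: fg_lift_gen. Qed.

(** By [circMl], sending [b] to [circ b c * c^-1] is a group morphism of [W], which reduces the
    claim to generators. *)
Lemma PX_eval_circPM u l :
  PX_eval (circPM u l) = circ (PX_eval u) (word_eval f l).
Proof.
rewrite /circPM PX_evalM PX_eval_gen; set h := fg_lift _.
elim/fg_ind: u => [|m|u v IHu IHv|u IHu].
- by rewrite /h fg_lift1 PX_eval1 mul1g circ1l.
- rewrite /h fg_lift_gen PX_evalM PX_evalV !PX_eval_gen word_eval_circ.
  by gsimpl.
- by rewrite /h fg_liftM !PX_evalM circMl -IHu -IHv; gsimpl.
- by rewrite /h fg_liftV !PX_evalV circVl -IHu; gsimpl.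
Qed.

(** Likewise [circMr] makes [b] to [a^-1 * circ a b] a group morphism; generators are handled by
    [PX_eval_circPM]. *)
Lemma PX_eval_circ u v : PX_eval (circ_l u v) = circ (PX_eval u) (PX_eval v).
Proof.
rewrite /circ_l PX_evalM; set h := fg_lift _.
elim/fg_ind: v => [|m|v w IHv IHw|v IHv].
- by rewrite /h fg_lift1 PX_eval1 mulg1 circ1r.
- by rewrite /h fg_lift_gen PX_evalM PX_evalV PX_eval_circPM PX_eval_gen; gsimpl.
- by rewrite /h fg_liftM !PX_evalM circMr -IHv -IHw; gsimpl.
- by rewrite /h fg_liftV !PX_evalV circVr -IHv; gsimpl.
Qed.


(** Generators of [P2] go to elements [circ_defect], those of [P2op] to elements [circ_defect_op];
    normality of the two centralisers extends their commutation to the normal closures. *)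
Lemma PX_eval_comm_P2 u : comm_P2 u -> PX_eval u = 1.
Proof.
have [kN _] := ker_is_normal PX_evalM.
apply: (smallest_sub kN) => _ [a [b [Pa Pb ->]]].
have Ca : circ_defect_op_centraliser (PX_eval a).
  have nN := circ_defect_op_centraliser_is_normal W.
  apply: (gen_normal_sub (preim_is_normal PX_evalM nN) _ Pa).
  move=> _ [m [l ->]]; rewrite /preimage /= !(PX_evalM, PX_evalV, PX_eval_gen).
  rewrite word_eval_circ => _ [c [d ->]]; exact: circ_defect_commute.
have Cb : centraliser (@circ_defect_op_centraliser W) (PX_eval b).
  have nN := circ_defect_op_bicentraliser_is_normal W.
  apply: (gen_normal_sub (preim_is_normal PX_evalM nN) _ Pb).
  move=> _ [m [l ->]]; rewrite /preimage /= !(PX_evalM, PX_evalV, PX_eval_gen).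
  by rewrite word_eval_circ => x cx; apply/commute_sym/cx; eexists _, _.
by rewrite /preimage /= !(PX_evalM, PX_evalV) -(Cb _ Ca) mulgK mulgV.
Qed.

Lemma PX_eval_circ_comm u : commutative_wire W -> circ_comm_PX u -> PX_eval u = 1.
Proof.
move=> cW; apply: (gen_normal_sub (ker_is_normal PX_evalM)) => _ [n [y [s ->]]].
rewrite /preimage /= PX_evalM PX_evalV !PX_eval_gen.
by rewrite (word_eval_perm cW (perm_mprod y s)) mulVg.
Qed.

Definition Fw_eval (a : Fw X) : W := PX_eval (repr a).

Lemma Fw_evalE u : Fw_eval (proj (comm_P2_normal X) u) = PX_eval u.
Proof. exact: (ker_repr (N := comm_P2_normal X) PX_evalM PX_eval_comm_P2). Qed.

Lemma Fw_evalM : {morph Fw_eval : a b / a * b}.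
Proof.
elim/projW=> u; elim/projW=> v.
by rewrite -[proj _ u * _]projM !Fw_evalE PX_evalM.
Qed.

Lemma Fw_eval_circ : {morph Fw_eval : a b / circ a b}.
Proof.
elim/projW=> u; elim/projW=> v.
by rewrite [circ _ _]Fw_circ_lE !Fw_evalE PX_eval_circ.
Qed.

Definition Fcw_eval (a : Fcw X) : W := Fw_eval (repr a).

Hypothesis cW : commutative_wire W.

Lemma Fcw_evalE a : Fcw_eval (proj (circ_comm_ideal X) a) = Fw_eval a.
Proof.
apply: (ker_repr (N := circ_comm_ideal X) Fw_evalM) => _ [u [v [Cu Dv ->]]].
by rewrite Fw_evalE PX_evalM PX_eval_circ_comm // PX_eval_comm_P2 // mulg1.
Qed.

Lemma Fcw_eval_morphism : wire_morphism Fcw_eval.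
Proof.
split; elim/projW=> a; elim/projW=> b.
  by rewrite -[proj _ a * _]projM !Fcw_evalE Fw_evalM.
by rewrite [circ _ _]quotw_circE !Fcw_evalE Fw_eval_circ.
Qed.

Lemma Fcw_eval_gen x : Fcw_eval (Fcw_gen x) = f x.
Proof. by rewrite Fcw_evalE Fw_evalE PX_eval_gen word_eval_letter. Qed.

End Extension.

(** * Commutativity of F_cw(X) and its generation by X *)

Section FreeCommutativeWire.
Variable X : Type.
Local Notation M := (freeSemigroup X).

Definition Fcw_class (u : freeGroup M) : Fcw X :=
  proj (circ_comm_ideal X) (proj (comm_P2_normal X) u).

Lemma Fcw_classW (Q : Fcw X -> Prop) :
  (forall u, Q (Fcw_class u)) -> forall a, Q a.
Proof. by move=> Qc; elim/projW; elim/projW. Qed.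

Lemma Fcw_classM : {morph Fcw_class : u v / u * v}.
Proof. by move=> u v; rewrite /Fcw_class [proj _ (u * v)]projM [LHS]projM. Qed.

Lemma Fcw_class_circ u v :
  circ (Fcw_class u) (Fcw_class v) = Fcw_class (circ_l u v).
Proof. by rewrite [LHS]quotw_circE [circ _ _]Fw_circ_lE. Qed.

Lemma circ_l_pgen m l : circ_l (pgen m) (pgen l) = pgen (mcirc m l) :> freeGroup M.
Proof. by rewrite /circ_l /circPM !fg_lift_gen; gsimpl. Qed.

Lemma Fcw_class_mcirc m l :
  Fcw_class (pgen (mcirc m l)) = circ (Fcw_class (pgen m)) (Fcw_class (pgen l)).
Proof. by rewrite Fcw_class_circ circ_l_pgen. Qed.

Lemma Fcw_class_perm m l : perm_eq (mword m) (mword l) ->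
  Fcw_class (pgen m) = Fcw_class (pgen l).
Proof.
move=> /perm_mwordP[n [x [s [-> ->]]]]; apply/esym/projP.
(* A generating circle commutator, with trivial factor in [comm_P2]. *)
exists ((pgen (mprod x))^-1 * pgen (mprod (x \o s))), 1.
split; last by rewrite mulg1 [RHS]projM [proj _ _^-1]projV.
  by apply: sub_gen_smallest; exists n, x, s.
exact: gen_subgroup1.
Qed.

Lemma Fcw_commutative : commutative_wire (Fcw X).
Proof.
elim/Fcw_classW=> u; elim/Fcw_classW=> v; apply: (fg_commutative_circ Fcw_classM).
move=> m l; rewrite -!Fcw_class_mcirc; apply: Fcw_class_perm.
by rewrite !mword_circ perm_catC.
Qed.

Lemma Fcw_morphism_eq (W : wireType) (g h : Fcw X -> W) :
  wire_morphism g -> wire_morphism h ->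
  (forall x, g (Fcw_gen x) = h (Fcw_gen x)) -> g =1 h.
Proof.
move=> [gM gc] [hM hc] gh; elim/Fcw_classW=> u.
apply: (fg_hom_eq (g := g \o Fcw_class) (h := h \o Fcw_class)).
- by move=> a b /=; rewrite Fcw_classM gM.
- by move=> a b /=; rewrite Fcw_classM hM.
(* On words, induct on the length: [(x, y :: s)] is the letter [x] followed by the shorter word
   [(y, s)]. *)
case=> x s /=; elim: s x => [|y s IH] x; first exact: gh.
rewrite -[fg_gen _]/(pgen (mcirc (letter x) (y, s))) Fcw_class_mcirc gc hc.
by rewrite [g (Fcw_class (pgen (y, s)))]IH [g _]gh.
Qed.

End FreeCommutativeWire.

Theorem corollary4p3 (X : Type) :
  is_free_commutative_wire X (Fcw X) (@Fcw_gen X).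
Proof.
split=> [|W f cW]; first exact: Fcw_commutative.
have evalP := Fcw_eval_morphism f cW; exists (Fcw_eval f); split.
  by split=> // x; apply: Fcw_eval_gen.
move=> g [gP gf]; apply/funext; apply: Fcw_morphism_eq => // x.
by rewrite gf; apply: Fcw_eval_gen.
Qed.
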